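(* Let $a<b$ be real numbers and $I=[a,b]$. Let $f:I\to I$ be a continuous piecewise monotone mapping which is essentially transitive, and let $(\psi,g)$ be a reduction of $f$. Then $\psi$ is a homeomorphism, and so in particular $f$ and $g$ are conjugate.
   Context: $I=[a,b]$ with $a<b$ real; $\mathrm{C}(I)$ is the set of continuous mappings $I\to I$; $f^n$ denotes the $n$-th iterate of $f$ ($f^0=\mathrm{id}_I$). Piecewise monotone: $f\in \mathrm{C}(I)$ is piecewise monotone if there exist $p\ge 0$ and $a=d_0<d_1<\cdots<d_p<d_{p+1}=b$ such that $f$ is strictly monotone on each $[d_k,d_{k+1}]$, $0\le k\le p$. $\mathrm{M}(I)$ denotes the set of piecewise monotone mappings in $\mathrm{C}(I)$. Reduction: $\mathrm{V}(I)=\{\psi\in \mathrm{C}(I): \psi \text{ is increasing and surjective}\}$, where increasing means only $\psi(x)\ge\psi(y)$ whenever $x\ge y$. A pair $(\psi,g)$ with $\psi\in \mathrm{V}(I)$ and $g\in \mathrm{M}(I)$ is a reduction of $f\in \mathrm{M}(I)$ if $\psi\circ f=g\circ\psi$. Conjugate: $g,h\in \mathrm{C}(I)$ are conjugate if there is a homeomorphism $\varphi:I\to I$ with $\varphi\circ g=h\circ\varphi$. Cycles: $B\subset I$ is $f$-invariant if $f(B)\subset B$. A closed set $C\subset I$ is an $f$-cycle with period $m\ge 1$ if $C$ is the disjoint union of non-trivial closed intervals $B_0,\dots,B_{m-1}$ with $f(B_{k-1})\subset B_k$ for $1\le k\le m-1$ and $f(B_{m-1})\subset B_0$. An $f$-cycle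 $C$ is transitive if every closed $f$-invariant subset $F$ of $C$ satisfies $F=C$ or $\mathrm{int}(F)=\varnothing$. For $B\subset I$, $\mathrm{E}(B,f)=\{x\in I: f^n(x)\in B \text{ for some } n\ge 0\}$. A mapping $f\in \mathrm{C}(I)$ is essentially transitive if there exists a transitive $f$-cycle $C$ such that $I\setminus \mathrm{E}(C,f)$ is countable (possibly finite or empty). *)

(* Defs.v *)
From mathcomp Require Import all_boot all_order all_algebra.
From mathcomp Require Import all_classical all_reals all_analysis.
Import Order.TTheory GRing.Theory Num.Theory.
Import numFieldTopology.Exports numFieldNormedType.Exports.

Set Implicit Arguments.
Unset Strict Implicit.
Unset Printing Implicit Defensive.

Local Open Scope classical_set_scope.
Local Open Scope ring_scope.

(* A mapping I -> I with I = [a, b] is encoded as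
   a function R -> R of which only the values on I matter: continuity is that
   of the restriction to I, equations are required on I only, and "closed" and
   "interior" are relative to the subspace topology of I. *)

Definition itv_set (R : realType) (a b : R) : set R := `[a, b]%classic.

Definition cont_self_map (R : realType) (a b : R) (f : R -> R) : Prop :=
  set_fun (itv_set a b) (itv_set a b) f /\ {within itv_set a b, continuous f}.

Definition strictly_monotone_on (R : realType) (A : set R) (f : R -> R) : Prop :=
  (forall x y, A x -> A y -> x < y -> f x < f y) \/
  (forall x y, A x -> A y -> x < y -> f y < f x).

(* Only the values d 0, ..., d p.+1 of d matter. *)
Definition piecewise_monotone (R : realType) (a b : R) (f : R -> R) : Prop :=
  cont_self_map a b f /\
  exists (p : nat) (d : nat -> R),
    [/\ d 0%N = a,
        d p.+1 = b,
        (forall k, (k <= p)%N -> d k < d k.+1) &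
        (forall k, (k <= p)%N ->
           strictly_monotone_on `[d k, d k.+1]%classic f)].

Definition increasing_surj (R : realType) (a b : R) (psi : R -> R) : Prop :=
  [/\ cont_self_map a b psi,
      (forall x y, itv_set a b x -> itv_set a b y -> y <= x -> psi y <= psi x) &
      set_surj (itv_set a b) (itv_set a b) psi].

Definition reduction (R : realType) (a b : R) (f psi g : R -> R) : Prop :=
  [/\ increasing_surj a b psi,
      piecewise_monotone a b g &
      forall x, itv_set a b x -> psi (f x) = g (psi x)].

Definition self_homeo (R : realType) (a b : R) (phi : R -> R) : Prop :=
  cont_self_map a b phi /\
  exists chi : R -> R,
    [/\ cont_self_map a b chi,
        (forall x, itv_set a b x -> chi (phi x) = x) &
        (forall x, itv_set a b x -> phi (chi x) = x)].

Definition conjugate_maps (R : realType) (a b : R) (g h : R -> R) : Prop :=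
  exists phi : R -> R,
    self_homeo a b phi /\ forall x, itv_set a b x -> phi (g x) = h (phi x).

Definition invariant_set (R : realType) (f : R -> R) (B : set R) : Prop :=
  f @` B `<=` B.

Definition closed_in_itv (R : realType) (a b : R) (F : set R) : Prop :=
  closed (F : set (subspace (itv_set a b))).

Definition interior_in_itv (R : realType) (a b : R) (F : set R) : set R :=
  (F : set (subspace (itv_set a b)))°.

(* The components are B k = [c k, d k] for k < m; other values of c, d are junk. *)
Definition cycle_period (R : realType) (a b : R) (f : R -> R) (C : set R)
    (m : nat) : Prop :=
  [/\ (0 < m)%N,
      C `<=` itv_set a b,
      closed_in_itv a b C &
      exists c d : nat -> R, let B k : set R := `[c k, d k]%classic in
        [/\ (forall k, (k < m)%N -> c k < d k),
            trivIset [set k | (k < m)%N] B,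
            C = \bigcup_(k in [set k | (k < m)%N]) B k,
            (forall k, (1 <= k <= m.-1)%N -> f @` B k.-1 `<=` B k) &
            f @` B m.-1 `<=` B 0%N]].

Definition is_cycle (R : realType) (a b : R) (f : R -> R) (C : set R) : Prop :=
  exists m : nat, cycle_period a b f C m.

Definition transitive_cycle (R : realType) (a b : R) (f : R -> R) (C : set R)
    : Prop :=
  is_cycle a b f C /\
  forall F : set R, F `<=` C -> closed_in_itv a b F -> invariant_set f F ->
    F = C \/ interior_in_itv a b F = set0.

Definition eventually_in (R : realType) (a b : R) (B : set R) (f : R -> R)
    : set R :=
  [set x | itv_set a b x /\ exists n : nat, B (iter n f x)].

Definition essentially_transitive (R : realType) (a b : R) (f : R -> R)
    : Prop :=
  exists C : set R,
    transitive_cycle a b f C /\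
    countable (itv_set a b `\` eventually_in a b C f).

(* Main.v *)
(** Suppose [psi] collapses a non-trivial interval [J]. Piecewise monotone maps
    have countable fibres and [J] is uncountable, so some iterate [f^n J]
    overlaps the transitive cycle [C] in a non-trivial interval [K], on which
    [psi] takes a single value [z]. By transitivity some [f^n x] with [x] in [K]
    and [n > 0] returns to [K], so [z] is [g]-periodic; the points of [C] that
    [psi] sends into the finite [g]-orbit of [z] form a closed invariant set
    containing [K], hence all of [C]. Thus [psi] has finite image on [C], and,
    as all but countably many points eventually enter [C] and [g] has countable
    fibres, countable image on [[a, b]], contradicting surjectivity. *)
Require Import Defs.
From mathcomp Require Import all_boot all_order all_algebra.
From mathcomp Require Import all_classical all_reals all_analysis.
From mathcomp Require Import lra.
Import Order.TTheory GRing.Theory Num.Theory.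
Import numFieldTopology.Exports numFieldNormedType.Exports.
Set Implicit Arguments.
Unset Strict Implicit.
Unset Printing Implicit Defensive.
Local Open Scope classical_set_scope.
Local Open Scope ring_scope.

(** * Intervals and maps with countable fibres *)

Lemma itv_setP (R : realType) (a b x : R) : itv_set a b x <-> a <= x <= b.
Proof. by rewrite /itv_set /= in_itv. Qed.

Lemma subitv_set (R : realType) (a b u v : R) :
  itv_set a b u -> itv_set a b v -> itv_set u v `<=` itv_set a b.
Proof.
move=> /itv_setP/andP[au _] /itv_setP/andP[_ vb] x /itv_setP/andP[ux xv].
by apply/itv_setP; rewrite (le_trans au ux) (le_trans xv vb).
Qed.

Lemma itv_set_uncountable (R : realType) (u v : R) :
  u < v -> ~ countable (itv_set u v).
Proof.
move=> uv /countable_lebesgue_measure0; rewrite lebesgue_measure_itv /= lte_fin uv.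
by move=> -[] /eqP; rewrite subr_eq0 gt_eqF.
Qed.

Lemma subdivision_cover (R : realType) (d : nat -> R) (p : nat) (x : R) :
  d 0%N <= x <= d p.+1 -> exists2 k, (k <= p)%N & d k <= x <= d k.+1.
Proof.
elim: p => [|p IHp] /andP[d0x xd]; first by exists 0%N; rewrite ?d0x.
have [xdp|/ltW dpx] := leP x (d p.+1); last by exists p.+1; rewrite ?dpx.
by have [|k kp dk] := IHp; [rewrite d0x|exists k => //; exact: leqW].
Qed.

Lemma strictly_monotone_on_inj (R : realType) (A : set R) (f : R -> R) (x y : R) :
  strictly_monotone_on A f -> A x -> A y -> f x = f y -> x = y.
Proof.
move=> fmono Ax Ay fxy; apply/eqP; case: ltgtP => // xy; case: fmono => fmono;
  [have := fmono _ _ Ax Ay xy|have := fmono _ _ Ax Ay xy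
  |have := fmono _ _ Ay Ax xy|have := fmono _ _ Ay Ax xy];
  by rewrite fxy ltxx.
Qed.

(** Phrased with countable sets instead of single points, so that the property passes to iterates by
    plain induction. *)
Definition countable_to_one (R : realType) (a b : R) (f : R -> R) : Prop :=
  forall Y : set R, countable Y -> countable (itv_set a b `&` f @^-1` Y).

Lemma piecewise_monotone_countable_to_one (R : realType) (a b : R) (f : R -> R) :
  piecewise_monotone a b f -> countable_to_one a b f.
Proof.
move=> [_ [p [d [d0 dp _ fmono]]]] Y cY.
pose F (k : nat) := itv_set (d k) (d k.+1) `&` f @^-1` Y.
apply: (@sub_countable _ _ _ (\bigcup_(k in `I_p.+1) F k)).
  apply: subset_card_le => x [/itv_setP abx Yfx].
  have [|k kp dk] := @subdivision_cover R d p x; first by rewrite d0 dp.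
  by exists k => //; split => //; apply/itv_setP.
apply: bigcup_countable => // k /= kp.
(* By injectivity the part of the preimage in one piece is equinumerous with a subset of [Y]. *)
have Finj : {in F k &, injective f}.
  move=> x y /set_mem[xk _] /set_mem[yk _].
  exact: (strictly_monotone_on_inj (fmono k kp)).
rewrite -(eq_countable (inj_card_eq Finj)).
by apply: sub_countable cY; apply: subset_card_le => _ [x [_ Yfx] <-].
Qed.

Lemma countable_to_one_iter (R : realType) (a b : R) (f : R -> R) (n : nat) :
  cont_self_map a b f -> countable_to_one a b f -> countable_to_one a b (iter n f).
Proof.
move=> [fI _] cf; elim: n => [|n IHn] Y cY.
  by apply: sub_countable cY; apply: subset_card_le => x [].
apply: sub_countable (cf _ (IHn _ cY)); apply: subset_card_le => x [Ix Yx].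
by split => //; split; [exact: fI|rewrite /= -iterSr].
Qed.

Lemma cont_self_map_iter (R : realType) (a b : R) (f : R -> R) (n : nat) :
  cont_self_map a b f -> cont_self_map a b (iter n f).
Proof.
move=> [fI fcont]; elim: n => [|n [gI gcont]].
  by split => //; apply: continuous_subspaceT => x; exact: cvg_id.
split => [x Ix|]; first by apply: fI; exact: gI.
(* As [f] is continuous only relative to [[a, b]], the iterate has to be seen as a continuous map
   into the subspace before composing. *)
pose G : {fun itv_set a b >-> itv_set a b} := mkfun gI.
have Gcont := @subspaceT_continuous _ _ _ _ G gcont.
move=> x; apply: (@continuous_comp (subspace (itv_set a b))
  (subspace (itv_set a b)) _ G f x); [exact: Gcont|exact: fcont].
Qed.

(** Countable fibres prevent [h] from being constant on the uncountable [[u, v]], so by the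
    intermediate value theorem the image contains a non-trivial interval with endpoint [h x]. The
    strict bounds on [h x] leave room to trim it to [[c, e]] on whichever side it lies. *)
Lemma image_itv_contains_itv (R : realType) (a b u v c e x : R) (h : R -> R) :
  {within itv_set a b, continuous h} -> countable_to_one a b h ->
  itv_set u v `<=` itv_set a b -> u < v -> itv_set u v x -> c < h x < e ->
  exists s t : R, s < t /\ itv_set s t `<=` h @` itv_set u v `&` itv_set c e.
Proof.
move=> hcont ch uvI uv xuv /andP[cx xe].
have [w wuv hwx] : exists2 w, itv_set u v w & h w <> h x.
  apply: contrapT => hconst; apply: (itv_set_uncountable uv).
  apply: sub_countable (ch [set h x] (countable1 _)); apply: subset_card_le => w wuv.
  split; first exact: uvI.
  by apply: contrapT => hwx; apply: hconst; exists w.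
have hrange : forall y, Num.min (h w) (h x) <= y <= Num.max (h w) (h x) ->
    (h @` itv_set u v) y.
  move=> y hy; have [wx|/ltW xw] := leP w x.
  - have wxI : itv_set w x `<=` itv_set a b by apply: subset_trans uvI; exact: subitv_set.
    have [t] := IVT wx (continuous_subspaceW wxI hcont) hy.
    by move=> twx <-; exists t => //; apply: (subitv_set wuv xuv).
  - rewrite minC maxC in hy.
    have xwI : itv_set x w `<=` itv_set a b by apply: subset_trans uvI; exact: subitv_set.
    have [t] := IVT xw (continuous_subspaceW xwI hcont) hy.
    by move=> txw <-; exists t => //; apply: (subitv_set xuv wuv).
have [hwltx|hxltw|/hwx//] := ltgtP (h w) (h x).
- exists (Num.max (h w) c), (h x); split; first by rewrite gt_max hwltx.
  move=> y /itv_setP; rewrite ge_max => /andP[/andP[wy cy] yx]; split.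
    by apply: hrange; rewrite ge_min le_max wy yx orbT.
  by apply/itv_setP; rewrite cy (le_trans yx (ltW xe)).
- exists (h x), (Num.min (h w) e); split; first by rewrite lt_min hxltw.
  move=> y /itv_setP; rewrite le_min => /andP[xy /andP[yw ye]]; split.
    by apply: hrange; rewrite ge_min le_max xy yw orbT.
  by apply/itv_setP; rewrite ye (le_trans (ltW cx) xy).
Qed.

(** * Interiors, cycles and the image of a transitive cycle *)

Lemma interior_in_itv_neq0 (R : realType) (a b s t : R) (F : set R) :
  s < t -> itv_set s t `<=` F -> interior_in_itv a b F <> set0.
Proof.
move=> st stF F0; suff : interior_in_itv a b F ((s + t) / 2) by rewrite F0.
apply: (@filterS (subspace (itv_set a b)) _ _ `]s, t[%classic).
  move=> x /=; rewrite in_itv /= => /andP[sx xt].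
  by apply: stF; apply/itv_setP; rewrite !ltW.
apply: open_nbhs_nbhs; split.
  by apply: open_subspaceW; exact: interval_open.
by rewrite /= in_itv /=; lra.
Qed.

Lemma cycle_invariant (R : realType) (a b : R) (f : R -> R) (C : set R) :
  is_cycle a b f C -> invariant_set f C.
Proof.
move=> [m [m0 _ _ [c [d [_ _ -> fB fB0]]]]] _ [x [k /= km Bx] <-].
have [kS|kE] := ltnP k.+1 m.
  by exists k.+1 => //; apply: fB; [rewrite /=; case: (m) kS|exists x].
exists 0%N => //; apply: fB0; exists x => //.
by have -> : m.-1 = k by apply/eqP; rewrite eqn_leq -(ltnS _ k) -(ltnS k) prednK // kE.
Qed.

Lemma semiconj_iter (R : realType) (a b : R) (f psi g : R -> R) (n : nat) (x : R) :
  set_fun (itv_set a b) (itv_set a b) f ->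
  (forall x, itv_set a b x -> psi (f x) = g (psi x)) ->
  itv_set a b x -> psi (iter n f x) = iter n g (psi x).
Proof.
move=> fI fg Ix; suff [_ ->] : itv_set a b (iter n f x) /\
  psi (iter n f x) = iter n g (psi x) by [].
by elim: n => //= n [Ifx <-]; split; [exact: fI|exact: fg].
Qed.

Lemma countable_image_transitive_cycle
    (R : realType) (a b u v z : R) (f psi g : R -> R) (C : set R) :
  cont_self_map a b f -> countable_to_one a b f -> transitive_cycle a b f C ->
  {within itv_set a b, continuous psi} ->
  (forall x, itv_set a b x -> psi (f x) = g (psi x)) ->
  u < v -> itv_set u v `<=` C -> (forall x, itv_set u v x -> psi x = z) ->
  countable (psi @` C).
Proof.
move=> fcsm cf [cycC transC] psicont fg uv uvC psiz.
have [fI fcont] := fcsm.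
have [CI clC] : C `<=` itv_set a b /\ closed_in_itv a b C by have [m []] := cycC.
have fC := cycle_invariant cycC.
have [n [x [uvx uvfx]]] : exists n x, itv_set u v x /\ itv_set u v (iter n.+1 f x).
  (* [F] collects the points of [C] whose orbit avoids the open interval; removing an open set keeps
     [F] closed. It misses the midpoint of [[u, v]], so transitivity gives it empty interior. *)
  pose F := C `&` \bigcap_n (iter n f @^-1` ~` `]u, v[%classic).
  have clF : closed_in_itv a b F.
    apply: closedI => //; apply: closed_bigI => n _.
    have /continuous_closedP := (cont_self_map_iter n fcsm).2; apply.
    by apply: open_closedC; exact: interval_open.
  have fF : invariant_set f F.
    move=> _ [x [Cx nx] <-]; split; first by apply: fC; exists x.
    by move=> n _; have := nx n.+1 I; rewrite /= -iterSr.
  have [|FC|F0] := transC F _ clF fF; first by move=> x [].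
    have : F ((u + v) / 2) by rewrite FC; apply: uvC; apply/itv_setP; lra.
    by move=> [_ /(_ 0%N I)]; rewrite /= in_itv /=; case; lra.
  have uuv : itv_set u v u by apply/itv_setP; rewrite lexx ltW.
  (* The window around [f u] is arbitrary; only a non-trivial interval inside the image of [[u, v]]
     matters. Without a return at a positive time, that interval would lie in [F]. *)
  have [||s [t [st stf]]] := @image_itv_contains_itv R a b u v (f u - 1) (f u + 1) u f
    fcont cf _ uv uuv; [by move=> x /uvC/CI|lra|].
  apply: contrapT => hF; apply: (interior_in_itv_neq0 st _ F0) => y /stf[[x uvx <-] _].
  split; first by apply: fC; exists x => //; exact: uvC.
  move=> n _ /=; rewrite in_itv /= => /andP[uy yv]; apply: hF; exists n, x.
  by split=> //; rewrite iterSr; apply/itv_setP; rewrite !ltW.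
have gz : iter n.+1 g z = z.
  rewrite -[in LHS](psiz x uvx) -(semiconj_iter _ fI fg) ?psiz //.
  by apply: CI; exact: uvC.
pose O : set R := [set iter i g z | i in `I_n.+1].
have finO : finite_set O by apply: finite_image.
apply: sub_countable (finite_set_countable finO); apply: subset_card_le.
pose F := C `&` psi @^-1` O.
suff FC : F = C by move=> _ [y Cy <-]; move: Cy; rewrite -FC => -[].
have [|||//|F0] := transC F.
- by move=> y [].
- apply: closedI => //; have /continuous_closedP := psicont; apply.
  exact: (accessible_finite_set_closed.1 (hausdorff_accessible (@Rhausdorff R))).
(* Applying [g] shifts the index in the orbit of [z]; the last index [n] wraps around to [0] by
   [gz]. *)
- move=> _ [y [Cy [i /= ilt iy]] <-]; split; first by apply: fC; exists y.
  rewrite /= fg; last exact: CI.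
  rewrite -iy; have [iltn|nlei] := ltnP i n; first by exists i.+1.
  have -> : i = n by apply/eqP; rewrite eqn_leq -ltnS ilt.
  by exists 0%N => //=; rewrite -[LHS]gz.
- case: (interior_in_itv_neq0 uv _ F0) => y uvy; split; first exact: uvC.
  by exists 0%N => //=; rewrite psiz.
Qed.

(** * Injectivity of the reduction and continuity of its inverse *)

Lemma reduction_injective (R : realType) (a b : R) (f psi g : R -> R) :
  a < b -> piecewise_monotone a b f -> essentially_transitive a b f ->
  reduction a b f psi g -> set_inj (itv_set a b) psi.
Proof.
move=> ab fpm [C [transC cE]] [[[psiI psicont] psile psisurj] gpm fg].
have [fcsm gcsm] : cont_self_map a b f /\ cont_self_map a b g.
  by split; [case: fpm|case: gpm].
have fI := fcsm.1; have cf := piecewise_monotone_countable_to_one fpm.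
have cg := piecewise_monotone_countable_to_one gpm.
have [[m [m0 CI _ [c [d [cd _ CE _ _]]]]] _] := transC.
suff inj : forall x y, itv_set a b x -> itv_set a b y -> psi x = psi y -> ~ x < y.
  move=> x y /set_mem Ix /set_mem Iy pxy; apply/eqP.
  by case: ltgtP => // [/(inj _ _ Ix Iy pxy)|/(inj _ _ Iy Ix (esym pxy))].
move=> x y Ix Iy pxy xy; have xyI := subitv_set Ix Iy.
(* [Y] contains all endpoints of components of [C]. A point [w] whose orbit avoids [Y] enters [C] in
   the interior of a component, as the strict bounds of [image_itv_contains_itv] demand. *)
pose Y : set R := range c `|` range d.
have cY : countable Y.
  rewrite /Y -bigcup2E; apply: bigcup_countable => // -[|[|i]] _ /=;
    [| |exact: countable0]; exact: card_image_le.
have [w [xyw Ew nYw]] : exists w, [/\ itv_set x y w, eventually_in a b C f w &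
    forall n, ~ Y (iter n f w)].
  apply: contrapT => noW; apply: (itv_set_uncountable xy).
  pose Z := (itv_set a b `\` eventually_in a b C f) `|`
    \bigcup_n (itv_set a b `&` iter n f @^-1` Y).
  apply: (@sub_countable _ _ _ Z).
    apply: subset_card_le => w xyw; apply: contrapT => nZ; apply: noW; exists w.
    split => //; first by apply: contrapT => nE; apply: nZ; left; split => //; exact: xyI.
    by move=> n Yn; apply: nZ; right; exists n => //; split => //; exact: xyI.
  rewrite /Z -bigcup2E; apply: bigcup_countable => // -[|[|i]] _ /=;
    [exact: cE| |exact: countable0].
  by apply: bigcup_countable => // n _; exact: countable_to_one_iter.
have [_ [n Cn]] := Ew.
move: (Cn); rewrite {1}CE => -[k /= km /itv_setP/andP[ckw wdk]].
have [|s [t [st stf]]] := @image_itv_contains_itv R a b x y (c k) (d k) w (iter n f)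
  (cont_self_map_iter n fcsm).2 (countable_to_one_iter n fcsm cf) xyI xy xyw.
  have [nc nd] : iter n f w <> c k /\ iter n f w <> d k.
    by split=> E; apply: (nYw n); rewrite E; [left|right]; exists k.
  by rewrite !lt_neqAle ckw wdk !andbT; apply/andP; split; apply/eqP => // /esym.
have stC : itv_set s t `<=` C by move=> r /stf[_ ckr]; rewrite CE; exists k.
(* Monotonicity squeezes [psi] to the constant [psi x] on [[x, y]], and the semiconjugacy carries
   this to the [n]-th image. *)
have psist r : itv_set s t r -> psi r = iter n g (psi x).
  move=> /stf[[q xyq <-] _]; have Iq := xyI _ xyq.
  rewrite (semiconj_iter _ fI fg) //; congr (iter n g _).
  move/itv_setP : xyq => /andP[xq qy]; apply/eqP.
  by rewrite eq_le (psile _ _ Iq Ix xq) andbT pxy psile.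
have cpsiC := countable_image_transitive_cycle fcsm cf transC psicont fg st stC psist.
apply: (itv_set_uncountable ab).
pose Z := psi @` (itv_set a b `\` eventually_in a b C f) `|`
  \bigcup_i (itv_set a b `&` iter i g @^-1` (psi @` C)).
apply: (@sub_countable _ _ _ Z).
  apply: subset_card_le => _ /psisurj[r Ir <-].
  have [[_ [i Ci]]|nE] := pselect (eventually_in a b C f r); last by left; exists r.
  right; exists i => //; split; first exact: psiI.
  by rewrite /= -(semiconj_iter _ fI fg) //; exists (iter i f r).
rewrite /Z -bigcup2E; apply: bigcup_countable => // -[|[|i]] _ /=;
  [| |exact: countable0].
- by apply: sub_countable cE; exact: card_image_le.
- by apply: bigcup_countable => // i _; exact: countable_to_one_iter.
Qed.

Lemma increasing_surj_inj_homeo (R : realType) (a b : R) (psi : R -> R) :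
  a < b -> increasing_surj a b psi -> set_inj (itv_set a b) psi ->
  self_homeo a b psi.
Proof.
move=> ab [psicsm psile psisurj] psiinj; split => //.
have [chi chiP] : exists chi : R -> R, forall x, itv_set a b x ->
    itv_set a b (chi x) /\ psi (chi x) = x.
  (* Choice needs a value everywhere; outside [[a, b]] the witness [x] is a default. *)
  have /choice[chi] : forall x, exists y, itv_set a b x -> itv_set a b y /\ psi y = x.
    move=> x; have [/psisurj[y Iy <-]|nIx] := pselect (itv_set a b x); first by exists y.
    by exists x => /nIx.
  by move=> chiP; exists chi.
have psiK x : itv_set a b x -> chi (psi x) = x.
  move=> Ix; have [Ic cE] := chiP _ (psicsm.1 x Ix).
  by apply: psiinj => //; exact: mem_set.
have chimono : forall x y, itv_set a b x -> itv_set a b y -> x <= y -> chi x <= chi y.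
  move=> x y Ix Iy xy; have [Icx px] := chiP _ Ix; have [Icy py] := chiP _ Iy.
  rewrite leNgt; apply/negP => yx.
  have yx' := psile _ _ Icx Icy (ltW yx); rewrite px py in yx'.
  have xE : x = y by apply/eqP; rewrite eq_le xy yx'.
  by move: yx; rewrite xE ltxx.
have Ia : itv_set a b a by apply/itv_setP; rewrite lexx ltW.
have Ib : itv_set a b b by apply/itv_setP; rewrite lexx ltW.
exists chi; split => //; last by move=> x /chiP[].
split; first by move=> x /chiP[].
(* A monotone map is continuous once it attains every value between its endpoint values; here [y] is
   attained at [psi y]. *)
apply: segment_inc_surj_continuous.
  move=> x y Ix Iy; apply/idP/idP; last exact: chimono.
  have [Icx px] := chiP _ Ix; have [Icy py] := chiP _ Iy.
  by move=> /(psile _ _ Icy Icx); rewrite px py.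
move=> y cy; have Iy := subitv_set (chiP _ Ia).1 (chiP _ Ib).1 cy.
by exists (psi y); [exact: psicsm.1|exact: psiK].
Qed.

Theorem proposition2 (R : realType) (a b : R) (f psi g : R -> R) :
  a < b ->
  piecewise_monotone a b f ->
  essentially_transitive a b f ->
  reduction a b f psi g ->
  self_homeo a b psi /\ conjugate_maps a b f g.
Proof.
move=> ab fpm ft red; have [psiV _ fg] := red.
have psih := increasing_surj_inj_homeo ab psiV (reduction_injective ab fpm ft red).
by split => //; exists psi.
Qed.
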